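(* Let $\varepsilon_0>0$ be fixed and let $g$ be a convex composition of atomic functions as described in the context. For any $\alpha>0$, let $P_{\alpha}$ be a maximizer of $$\max_{P\in\mathbb{O}^{n\times k}}\Big\{g(P)-\alpha\sum_{i=1}^n\sqrt{\operatorname{tr}(P^{\mathrm T}e_ie_i^{\mathrm T}P)+\varepsilon_0^2}\Big\}.$$ Consider $\{P_{\alpha}:\alpha>0\}$ and let $P_*$ be an accumulation point of $\{P_{\alpha}:\alpha>0\}$ as $\alpha\to\infty$. Then $P_*\in\mathbb{O}^{n\times k}$ and $$\sum_{i=1}^n\sqrt{\|P_{*(i,:)}\|_2^2+\varepsilon_0^2}= k\sqrt{1+\varepsilon_0^2}+(n-k)\varepsilon_0,$$ and thus $P_*$ can be permuted, through permuting its rows, to a matrix of the form $$\begin{bmatrix}\widehat P\\ 0_{(n-k)\times k}\end{bmatrix}\quad\text{with } \widehat P\in\mathbb{O}^{k\times k}.$$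
   Context: $n,k$ are integers with $1\le k\le n$. $\mathbb{O}^{n\times k}:=\{P\in\mathbb{R}^{n\times k}: P^{\mathrm T}P=I_k\}$ is the Stiefel manifold (so $\mathbb{O}^{k\times k}$ is the set of $k\times k$ real orthogonal matrices). $e_i$ is the $i$th column of $I_n$, $P_{(i,:)}$ is the $i$th row of $P$, and $\|\cdot\|_2$ is the Euclidean norm, so $\operatorname{tr}(P^{\mathrm T}e_ie_i^{\mathrm T}P)=\|P_{(i,:)}\|_2^2$. Assumptions on $g$: $g$ is real-valued and smooth on some neighborhood $\{P\in\mathbb{R}^{n\times k}:\|P^{\mathrm T}P-I_k\|<\delta\}$ ($\delta>0$ a constant, $\|\cdot\|$ some matrix norm) of $\mathbb{O}^{n\times k}$, and $g=\psi\circ T_0$ with $T_0(P)=[g_1(P),\ldots,g_N(P)]^{\mathrm T}$, where $\psi:\mathfrak{D}\subseteq\mathbb{R}^N\to\mathbb{R}$ is convex and differentiable, $T_0$ maps $\mathbb{O}^{n\times k}$ into $\mathfrak{D}$, and there are a subset $\mathbb{P}\subseteq\mathbb{O}^{n\times k}$, symmetric matrix-valued functions $H_i(P)\in\mathbb{R}^{n\times n}$ ($1\le i\le N$), and constants $\underline{\beta}_i\ge 0$ and $\underline{\gamma}_i=2+\underline{\beta}_i$ such that (1) $\operatorname{tr}(P^{\mathrm T}H_i(P)P)=\underline{\gamma}_i\,g_i(P)$ for all $P\in\mathbb{P}$ and $1\le i\le N$; and (2) given $\widehat P\in\mathbb{O}^{n\times k}$ and $P\in\mathbb{P}$, there exists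 $Q\in\mathbb{O}^{k\times k}$ (the same for all $i$) such that $\widetilde P=\widehat PQ\in\mathbb{P}$ and $\operatorname{tr}(\widehat P^{\mathrm T}H_i(P)\widehat P)\le 2\,g_i(\widetilde P)+\underline{\beta}_i\,g_i(P)$ for $1\le i\le N$. For each $\alpha>0$, $P_\alpha$ is any (global) maximizer. $P_*$ is an accumulation point of $\{P_\alpha:\alpha>0\}$ as $\alpha\to\infty$ if there is an increasing sequence $\alpha_j\to\infty$ with $P_{\alpha_j}\to P_*$. When $k=n$ the zero block is empty. *)

(* Defs.v *)
(* Built on MathComp and MathComp-Analysis; matrices carry the library's
   (entrywise maximum) norm and the topology it induces. *)
From HB Require Import structures.
From mathcomp Require Import all_boot all_order all_algebra all_fingroup.
From mathcomp Require Import all_classical all_reals all_analysis.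

Set Implicit Arguments.
Unset Strict Implicit.
Unset Printing Implicit Defensive.

Import Order.TTheory GRing.Theory Num.Theory.
Import numFieldNormedType.Exports.

Local Open Scope classical_set_scope.
Local Open Scope ring_scope.

Definition stiefel (R : realType) (n k : nat) : set 'M[R]_(n, k) :=
  [set P | P^T *m P = 1%:M].

Definition norm2 (R : realType) (k : nat) (v : 'rV[R]_k) : R :=
  Num.sqrt (\sum_(j < k) v 0 j ^+ 2).

Record matrix_norm (R : realType) (m n : nat) (nu : 'M[R]_(m, n) -> R) : Prop :=
  MatrixNorm {
    matrix_norm_ge0 : forall A, 0 <= nu A;
    matrix_norm_eq0 : forall A, nu A = 0 -> A = 0;
    matrix_normZ : forall (a : R) A, nu (a *: A) = `|a| * nu A;
    matrix_normD : forall A B, nu (A + B) <= nu A + nu B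
  }.

Definition stiefel_nbhd (R : realType) (n k : nat) (nu : 'M[R]_k -> R)
    (delta : R) : set 'M[R]_(n, k) :=
  [set P | nu (P^T *m P - 1%:M) < delta].

(* Frechet differentiability at every point of U, with a continuous
   derivative.  In finite dimension, continuity of the derivative for the
   operator norm is continuity of each of its values P |-> 'd f P V.  The
   sets U of interest are open, so the values of f off U are irrelevant. *)
Definition C1_on (R : realType) (V : normedModType R) (U : set V)
    (f : V -> R) : Prop :=
  (forall x, U x -> differentiable (f : V -> R^o) x) /\
  (forall v, {within U, continuous (fun x => 'd (f : V -> R^o) x v : R^o)}).

(* Differentiability at x relative to the domain D, which agrees with
   Frechet differentiability when D is a neighborhood of x.  Only the values
   of f on D matter, so a total function can stand for one defined on D. *)
Definition differentiable_in (R : realType) (N : nat) (D : set 'cV[R]_N)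
    (f : 'cV[R]_N -> R) (x : 'cV[R]_N) : Prop :=
  exists L : {linear 'cV[R]_N -> R^o},
    forall e : R, 0 < e ->
      \forall y \near within D (nbhs x),
        `|f y - (f x + L (y - x))| <= e * `|y - x|.

(* The two defining conditions of the atomic functions g_1, ..., g_N.  The
   functions are total; only their values at the points of PP and of the
   Stiefel manifold are constrained. *)
Record atomic_functions (R : realType) (n k N : nat)
    (PP : set 'M[R]_(n, k)) (H : 'I_N -> 'M[R]_(n, k) -> 'M[R]_n)
    (beta gamma : 'I_N -> R) (g_ : 'I_N -> 'M[R]_(n, k) -> R) : Prop :=
  AtomicFunctions {
    atomic_subset : PP `<=` @stiefel R n k;
    atomic_sym : forall i P, @stiefel R n k P -> (H i P)^T = H i P;
    atomic_beta_ge0 : forall i, 0 <= beta i;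
    atomic_gammaE : forall i, gamma i = 2 + beta i;
    atomic_trace : forall P, PP P -> forall i,
      \tr (P^T *m H i P *m P) = gamma i * g_ i P;
    atomic_ineq : forall Phat P, @stiefel R n k Phat -> PP P ->
      exists2 Q : 'M[R]_k, @stiefel R k k Q &
        PP (Phat *m Q) /\
        forall i, \tr (Phat^T *m H i P *m Phat)
                    <= 2 * g_ i (Phat *m Q) + beta i * g_ i P
  }.

(* The equality g = psi o T_0 is required wherever both sides make sense:
   at the points of U (the domain of g) that T_0 maps into D. *)
Record convex_atomic_composition (R : realType) (n k N : nat)
    (U : set 'M[R]_(n, k)) (D : set 'cV[R]_N) (psi : 'cV[R]_N -> R)
    (g_ : 'I_N -> 'M[R]_(n, k) -> R) (g : 'M[R]_(n, k) -> R) : Prop :=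
  ConvexAtomicComposition {
    cac_domain : convex_set (D : set (convex_lmodType 'cV[R]_N));
    cac_convex : @convex_function R 'cV[R]_N D psi;
    cac_differentiable : forall x, D x -> differentiable_in D psi x;
    cac_maps : forall P, @stiefel R n k P -> D (\col_i g_ i P);
    cac_comp : forall P, U P -> D (\col_i g_ i P) -> g P = psi (\col_i g_ i P)
  }.

(* delta_mx i 0 is the i-th column of the identity matrix. *)
Definition penalized (R : realType) (n k : nat) (eps0 : R)
    (g : 'M[R]_(n, k) -> R) (alpha : R) (P : 'M[R]_(n, k)) : R :=
  g P - alpha * \sum_(i < n)
    Num.sqrt (\tr (P^T *m (delta_mx i 0 : 'cV[R]_n)
                       *m (delta_mx i 0 : 'cV[R]_n)^T *m P) + eps0 ^+ 2).

Definition maximizer (R : realType) (T : Type) (A : set T) (F : T -> R)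
    (x : T) : Prop :=
  A x /\ forall y, A y -> F y <= F x.

Definition accumulation_at_pinfty (R : realType) (T : topologicalType)
    (X : R -> T) (x : T) : Prop :=
  exists a : R^nat,
    [/\ forall j, 0 < a j, increasing_seq a,
        a j @[j --> \oo] --> +oo & X (a j) @[j --> \oo] --> x].

(* Main.v *)
Require Import Defs.
From HB Require Import structures.
From mathcomp Require Import all_boot all_order all_algebra all_fingroup.
From mathcomp Require Import all_classical all_reals all_analysis.
From mathcomp Require Import ring lra.

Set Implicit Arguments.
Unset Strict Implicit.
Unset Printing Implicit Defensive.

Import Order.TTheory GRing.Theory Num.Theory.
Import numFieldNormedType.Exports.

Local Open Scope classical_set_scope.
Local Open Scope ring_scope.

(** At a maximizer [P_alpha], comparison with the feasible point [pid_mx k]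
    (the identity stacked over a zero block) gives
    [penalty P_alpha
      <= penalty (pid_mx k) + (g P_alpha - g (pid_mx k)) / alpha].
    Along a sequence [alpha_j -> +oo] with [P_(alpha_j) -> P_*], the point [P_*]
    is again on the Stiefel manifold, which is closed ([cvg_stiefel]), and [g]
    is continuous there, so [penalty P_* <= penalty (pid_mx k)] in the limit
    ([penalty_limit_le]).

    On the other hand [pid_mx k] minimizes the penalty.  The squared row norms
    [t_i] of a point of the Stiefel manifold are the diagonal entries of an
    orthogonal projector of trace [k], so they lie between 0 and 1 and sum to
    [k].  On this interval the strictly concave function
    [t |-> sqrt (t + eps ^ 2)] lies above its chord, with equality only at the
    endpoints ([sqrt_chord_leif]); as the chord is affine, its sum over the rows
    depends only on the sum of the [t_i], and equals
    [k sqrt (1 + eps ^ 2) + (n - k) eps].  This is [penalty_stiefel_leif].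

    Hence [P_*] attains the minimum, every [t_i] is [0] or [1], exactly [k] of
    them are [1], and a row permutation sends the zero rows to the bottom
    ([stiefel_zero_one_rows]). *)

(** * Squared row norms on the Stiefel manifold *)

Definition sqnorm_row (R : realType) (n k : nat) (P : 'M[R]_(n, k)) (i : 'I_n)
    : R :=
  \sum_(j < k) P i j ^+ 2.

Definition penalty (R : realType) (n k : nat) (eps : R) (P : 'M[R]_(n, k))
    : R :=
  \sum_(i < n) Num.sqrt (sqnorm_row P i + eps ^+ 2).

Section Rows.
Context (R : realType) (n k : nat).
Implicit Types P : 'M[R]_(n, k).

Lemma sqnorm_row_ge0 P i : 0 <= sqnorm_row P i.
Proof. by apply: sumr_ge0 => j _; exact: sqr_ge0. Qed.

Lemma norm2_row_sq P i : norm2 (row i P) ^+ 2 = sqnorm_row P i.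
Proof.
rewrite /norm2 sqr_sqrtr; last by apply: sumr_ge0 => j _; exact: sqr_ge0.
by apply: eq_bigr => j _; rewrite mxE.
Qed.

Lemma trace_row P (i : 'I_n) :
  \tr (P^T *m (delta_mx i 0 : 'cV[R]_n) *m (delta_mx i 0 : 'cV[R]_n)^T *m P)
  = sqnorm_row P i.
Proof.
rewrite -mulmxA trmx_delta -rowE -[X in X *m _]trmxK trmx_mul trmxK trmx_delta.
rewrite -rowE; apply: eq_bigr => j _.
by rewrite !mxE big_ord1 !mxE expr2.
Qed.

Lemma penalizedE (eps : R) g (alpha : R) P :
  penalized eps g alpha P = g P - alpha * penalty eps P.
Proof.
by congr (_ - _ * _); apply: eq_bigr => i _; rewrite trace_row.
Qed.

Lemma mulmx_trmx_diag P i : (P *m P^T) i i = sqnorm_row P i.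
Proof. by rewrite mxE; apply: eq_bigr => j _; rewrite mxE expr2. Qed.

Lemma stiefel_sum_sqnorm_row P :
  @stiefel R n k P -> \sum_(i < n) sqnorm_row P i = k%:R.
Proof.
move=> hP; rewrite -(mxtrace1 R k) -hP mxtrace_mulC.
by apply: eq_bigr => i _; rewrite mulmx_trmx_diag.
Qed.

(** [P *m P^T] is a symmetric idempotent, so its diagonal entry [t] is the sum
    of the squares of the entries in its row; in particular [t ^+ 2 <= t]. *)
Lemma stiefel_sqnorm_row_le1 P i : @stiefel R n k P -> sqnorm_row P i <= 1.
Proof.
move=> hP; set t := sqnorm_row P i.
have sym l : (P *m P^T) l i = (P *m P^T) i l.
  by rewrite -[in LHS](trmxK P) -trmx_mul mxE trmxK.
have tE : t = \sum_(l < n) (P *m P^T) i l ^+ 2.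
  have idem : P *m P^T *m (P *m P^T) = P *m P^T.
    by rewrite mulmxA -(mulmxA P) hP mulmx1.
  rewrite /t -mulmx_trmx_diag -[in LHS]idem mxE.
  by apply: eq_bigr => l _; rewrite sym expr2.
have tt : t ^+ 2 <= t.
  rewrite [leRHS]tE (bigD1 i) //= mulmx_trmx_diag lerDl.
  by apply: sumr_ge0 => l _; exact: sqr_ge0.
by have := sqnorm_row_ge0 P i; rewrite -/t => t0; nra.
Qed.

End Rows.

(** * The penalty is minimal exactly at zero-one row norms *)

(** With [s = sqrt (1 + eps ^+ 2)], the squares of the two sides differ by
    [t * (1 - t) * (s - eps) ^+ 2]. *)
Lemma sqrt_chord_leif (R : realType) (eps t : R) : 0 < eps -> 0 <= t <= 1 ->
  eps + t * (Num.sqrt (1 + eps ^+ 2) - eps) <= Num.sqrt (t + eps ^+ 2)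
    ?= iff ((t == 0) || (t == 1)).
Proof.
move=> e0 /andP[t0 t1]; set s := Num.sqrt (1 + _).
have s2 : s ^+ 2 = 1 + eps ^+ 2 by rewrite sqr_sqrtr ?addr_ge0 ?sqr_ge0.
have s0 : 0 <= s by exact: sqrtr_ge0.
have es : eps < s by nra.
have c0 : 0 <= eps + t * (s - eps).
  by rewrite addr_ge0 ?mulr_ge0 ?subr_ge0 // ltW.
have gap : t + eps ^+ 2
    = (eps + t * (s - eps)) ^+ 2 + t * (1 - t) * (s - eps) ^+ 2.
  (* The right side is eps^2 + t (s^2 - eps^2), and s^2 - eps^2 = 1. *)
  transitivity (t * (s ^+ 2 - eps ^+ 2) + eps ^+ 2); last by ring.
  by rewrite s2 addrK mulr1.
have gap0 : 0 <= t * (1 - t) * (s - eps) ^+ 2.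
  by rewrite mulr_ge0 ?sqr_ge0 // mulr_ge0 ?subr_ge0.
split.
  by rewrite -[X in X <= _]ger0_norm // -sqrtr_sqr ler_wsqrtr // gap lerDl.
rewrite -(eqrXn2 (n := 2)) ?sqrtr_ge0 // sqr_sqrtr; last first.
  by rewrite addr_ge0 ?sqr_ge0.
rewrite gap eq_sym -subr_eq0 addrAC subrr add0r !mulf_eq0 -orbA orbb.
by rewrite !subr_eq0 (gt_eqF es) orbF [1 == t]eq_sym.
Qed.

(** The lower bound is the sum of the chords, which the constraint
    [\sum_i sqnorm_row P i = k] makes independent of [P]. *)
Lemma penalty_stiefel_leif (R : realType) (n k : nat) (eps : R)
    (P : 'M[R]_(n, k)) : (k <= n)%N -> 0 < eps -> @stiefel R n k P ->
  k%:R * Num.sqrt (1 + eps ^+ 2) + (n - k)%:R * eps <= penalty eps P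
    ?= iff [forall i, (sqnorm_row P i == 0) || (sqnorm_row P i == 1)].
Proof.
move=> hkn e0 hP.
have := leif_sum (fun i (_ : true) => @sqrt_chord_leif R eps (sqnorm_row P i) e0
  (introT andP (conj (sqnorm_row_ge0 P i) (stiefel_sqnorm_row_le1 i hP)))).
rewrite big_split /= -mulr_suml (stiefel_sum_sqnorm_row hP) sumr_const card_ord.
suff -> : eps *+ n + k%:R * (Num.sqrt (1 + eps ^+ 2) - eps)
    = k%:R * Num.sqrt (1 + eps ^+ 2) + (n - k)%:R * eps by [].
by rewrite natrB // -mulr_natl; ring.
Qed.

Lemma stiefel_pid (R : realType) (n k : nat) : (k <= n)%N ->
  @stiefel R n k (pid_mx k).
Proof. by move=> hkn; rewrite /stiefel /= tr_pid_mx pid_mx_id // pid_mx_1. Qed.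

Lemma penalty_pid (R : realType) (n k : nat) (eps : R) :
  (k <= n)%N -> 0 < eps -> penalty eps (pid_mx k : 'M[R]_(n, k))
  = k%:R * Num.sqrt (1 + eps ^+ 2) + (n - k)%:R * eps.
Proof.
move=> hkn e0.
have [_ h] := penalty_stiefel_leif hkn e0 (stiefel_pid R hkn).
apply/esym/eqP; rewrite h; apply/forallP => i.
rewrite /sqnorm_row; have [ik|ki] := ltnP i k; apply/orP; [right|left].
  rewrite (bigD1 (Ordinal ik)) //= big1 ?addr0 ?mxE /= ?eqxx ?ik ?expr1n //.
  by move=> j; rewrite -val_eqE mxE eq_sym => /negbTE /= ->; rewrite expr0n.
by rewrite big1 // => j _; rewrite mxE ltnNge ki andbF expr0n.
Qed.

(** * Passing to the limit *)

Section Limits.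
Context (R : realType) (n k : nat).
Context (T : Type) (F : set_system T) {FF : ProperFilter F}.
Context (X : T -> 'M[R]_(n, k)) (P : 'M[R]_(n, k)).
Hypothesis XP : X @ F --> P.

Lemma cvg_entry i j : X x i j @[x --> F] --> P i j.
Proof.
exact: (cvg_comp _ (fun M : 'M[R]_(n, k) => M i j) XP
  (@coord_continuous _ _ _ i j P)).
Qed.

Lemma cvg_penalty (eps : R) : penalty eps (X x) @[x --> F] --> penalty eps P.
Proof.
apply: cvg_big => [|i _]; first exact: add_continuous.
apply: (continuous_cvg _ (@sqrt_continuous R _)).
apply: cvgD; last exact: cvg_cst.
apply: cvg_big => [|j _]; first exact: add_continuous.
under eq_fun do rewrite expr2.
by apply: cvgM; exact: cvg_entry.
Qed.

Lemma cvg_stiefel :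
  (\forall x \near F, @stiefel R n k (X x)) -> @stiefel R n k P.
Proof.
move=> hX; apply/matrixP => a b.
have c : (\sum_(l < n) X x l a * X x l b) @[x --> F]
    --> \sum_(l < n) P l a * P l b.
  apply: cvg_big => [|l _]; first exact: add_continuous.
  by apply: cvgM; exact: cvg_entry.
have d : (\sum_(l < n) X x l a * X x l b) @[x --> F] --> (1%:M : 'M[R]_k) a b.
  apply: cvg_near_cst; near=> x.
  have <- : (X x)^T *m X x = 1%:M by near: x.
  by rewrite mxE; apply: eq_bigr => l _; rewrite mxE.
rewrite -(cvg_unique _ c d) // mxE.
by apply: eq_bigr => l _; rewrite mxE.
Unshelve. all: by end_near. Qed.

End Limits.

(** Dividing the inequality by [a j] leaves [f j <= c + (g j - g0) / a j], where
    the last term vanishes in the limit because [g] converges. *)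
Lemma penalty_limit_le (R : realType) (a f g : R^nat) (c g0 fl gl : R) :
  (forall j, 0 < a j) -> a j @[j --> \oo] --> +oo ->
  f j @[j --> \oo] --> fl -> g j @[j --> \oo] --> gl ->
  (forall j, g0 - a j * c <= g j - a j * f j) -> fl <= c.
Proof.
move=> a_gt0 a_oo fP gP h.
have bound j : f j <= c + (a j)^-1 * (g j - g0).
  by rewrite -lerBlDl ler_pdivlMl //; have := h j; lra.
have u : c + (a j)^-1 * (g j - g0) @[j --> \oo] --> c + 0 * (gl - g0).
  apply: cvgD; first exact: cvg_cst.
  apply: cvgM; last by apply: cvgB => //; exact: cvg_cst.
  by apply/gtr0_cvgV0 => //; apply: nearW.
rewrite mul0r addr0 in u.
by apply: (ler_cvg_to fP u); apply: nearW.
Qed.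

(** * Moving the nonzero rows to the top *)

(** Listing [S] first and its complement next enumerates ['I_n], and any such
    enumeration is a permutation. *)
Lemma perm_set_prefix (n : nat) (S : {set 'I_n}) :
  exists s : 'S_n, forall i : 'I_n, (s i \in S) = (i < #|S|)%N.
Proof.
pose e := enum S ++ enum (~: S).
have sz : size e == n by rewrite size_cat -!cardE cardsC card_ord.
have pe : perm_eq (Tuple sz) (ord_tuple n).
  apply: uniq_perm => /=; rewrite ?enum_uniq //.
    rewrite cat_uniq !enum_uniq andbT /=; apply/hasPn => x.
    by rewrite !mem_enum inE.
  by move=> x; rewrite mem_cat !mem_enum inE orbN.
have /tuple_permP[s es] := pe; exists s => i.
have -> : s i = nth i e i.
  have : e = [tuple tnth (ord_tuple n) (s i0) | i0 < n] by exact: es.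
  by move=> ->; rewrite -tnth_nth tnth_mktuple tnth_ord_tuple.
rewrite nth_cat -cardE; case: ltnP => h.
  by rewrite -mem_enum mem_nth // -cardE.
have: nth i (enum (~: S)) (i - #|S|) \in enum (~: S).
  apply: mem_nth; rewrite -cardE ltn_subLR // cardsC card_ord //.
by rewrite mem_enum inE => /negbTE.
Qed.

(** Permuting rows preserves [P^T *m P], and zero rows do not contribute to it,
    so the top block inherits orthonormal columns. *)
Lemma stiefel_vanishing_rows (R : realType) (n k : nat) (hkn : (k <= n)%N)
    (P : 'M[R]_(n, k)) (s : 'S_n) : @stiefel R n k P ->
  (forall i : 'I_n, (k <= i)%N -> row (s i) P = 0) ->
  exists Phat : 'M[R]_k, @stiefel R k k Phat /\
    row_perm s P
      = castmx (subnKC hkn, erefl k) (col_mx Phat (0 : 'M[R]_(n - k, k))).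
Proof.
move=> hP hs.
pose A := castmx (esym (subnKC hkn), erefl k) (row_perm s P).
have AE : A = col_mx (usubmx A) 0.
  rewrite -[LHS]vsubmxK; congr col_mx; apply/matrixP => i j.
  rewrite !mxE castmxE !mxE /= cast_ord_id.
  have := hs (cast_ord (esym (esym (subnKC hkn))) (rshift k i)).
  by move=> /(_ (leq_addr _ _)) /rowP /(_ j); rewrite !mxE.
exists (usubmx A); split; last first.
  by rewrite -AE /A castmxKV.
have : A^T *m A = 1%:M.
  rewrite -hP; apply/matrixP => a b; rewrite !mxE.
  rewrite (reindex (fun i => cast_ord (esym (subnKC hkn)) ((s^-1)%g i))) /=;
    last first.
    apply: onW_bij; exists (fun i => s (cast_ord (subnKC hkn) i)) => i.
      by rewrite cast_ordKV permKV.
    by rewrite permK cast_ordK.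
  by apply: eq_bigr => i _; rewrite !mxE !castmxE !mxE /= !cast_ord_id esymK
    cast_ordKV permKV.
by rewrite AE tr_col_mx mul_row_col mulmx0 addr0 col_mxKu.
Qed.

(** The row norms sum to [k], so exactly [k] rows have norm one and the others
    vanish. *)
Lemma stiefel_zero_one_rows (R : realType) (n k : nat) (hkn : (k <= n)%N)
    (P : 'M[R]_(n, k)) : @stiefel R n k P ->
  (forall i, (sqnorm_row P i == 0) || (sqnorm_row P i == 1)) ->
  exists (s : 'S_n) (Phat : 'M[R]_k), @stiefel R k k Phat /\
    row_perm s P
      = castmx (subnKC hkn, erefl k) (col_mx Phat (0 : 'M[R]_(n - k, k))).
Proof.
move=> hP h01; pose S := [set i | sqnorm_row P i == 1]%SET.
have cS : #|S| = k.
  apply/eqP; rewrite -(eqr_nat R) -(stiefel_sum_sqnorm_row hP).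
  rewrite -sum1_card natr_sum big_mkcond; apply/eqP/eq_bigr => i _.
  by rewrite inE; case/orP: (h01 i) => /eqP ->;
    rewrite ?eqxx // eq_sym oner_eq0.
have [s hs] := perm_set_prefix S; exists s.
apply: stiefel_vanishing_rows => // i ki.
have : s i \notin S by rewrite hs cS -leqNgt.
rewrite inE => /negbTE n1; have := h01 (s i); rewrite n1 orbF.
rewrite psumr_eq0 => [/allP h|j _]; last exact: sqr_ge0.
apply/rowP => j; rewrite !mxE; apply/eqP.
by have := h j; rewrite mem_index_enum sqrf_eq0 /=; exact.
Qed.

(** * Limits of maximizers *)

Lemma stiefel_sub_nbhd (R : realType) (n k : nat) (nu : 'M[R]_k -> R)
    (delta : R) : matrix_norm nu -> 0 < delta ->
  @stiefel R n k `<=` stiefel_nbhd nu delta.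
Proof.
move=> hnu d0 P hP; rewrite /stiefel_nbhd /= hP subrr -(scale0r 0).
by rewrite (matrix_normZ hnu) normr0 mul0r.
Qed.

Theorem theorem5p5 (R : realType) (n k N : nat) (hk : (1 <= k)%N)
    (hkn : (k <= n)%N)
    (eps0 : R) (heps0 : 0 < eps0)
    (g : 'M[R]_(n, k) -> R)
    (nu : 'M[R]_k -> R) (hnu : matrix_norm nu)
    (delta : R) (hdelta : 0 < delta)
    (hg : C1_on (stiefel_nbhd nu delta) g)
    (D : set 'cV[R]_N) (psi : 'cV[R]_N -> R)
    (g_ : 'I_N -> 'M[R]_(n, k) -> R)
    (hcomp : convex_atomic_composition (stiefel_nbhd nu delta) D psi g_ g)
    (PP : set 'M[R]_(n, k)) (H : 'I_N -> 'M[R]_(n, k) -> 'M[R]_n)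
    (beta gamma : 'I_N -> R)
    (hatomic : atomic_functions PP H beta gamma g_)
    (Palpha : R -> 'M[R]_(n, k))
    (hmax : forall alpha : R, 0 < alpha ->
       maximizer (@stiefel R n k) (penalized eps0 g alpha) (Palpha alpha))
    (Pstar : 'M[R]_(n, k)) (hstar : accumulation_at_pinfty Palpha Pstar) :
  [/\ @stiefel R n k Pstar,
      \sum_(i < n) Num.sqrt (norm2 (row i Pstar) ^+ 2 + eps0 ^+ 2)
        = k%:R * Num.sqrt (1 + eps0 ^+ 2) + (n - k)%:R * eps0 &
      exists (s : 'S_n) (Phat : 'M[R]_k),
        @stiefel R k k Phat /\
        row_perm s Pstar =
          castmx (subnKC hkn, erefl k)
            (col_mx Phat (0 : 'M[R]_(n - k, k)))].
Proof.
case: hstar => a [a_gt0 _ a_oo aP].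
have hX j := (hmax _ (a_gt0 j)).1.
have hP : @stiefel R n k Pstar.
  by apply: (cvg_stiefel aP); apply: nearW => j; exact: hX.
have hc := penalty_stiefel_leif hkn heps0 hP.
set c := _ + _ in hc *.
have gP : g (Palpha (a j)) @[j --> \oo] --> g Pstar.
  apply: (continuous_cvg _ _ aP).
  apply: (@differentiable_continuous R 'M[R]_(n, k) R^o).
  exact: (hg.1 _ (stiefel_sub_nbhd hnu hdelta hP)).
have beats_pid j : g (pid_mx k) - a j * c
    <= g (Palpha (a j)) - a j * penalty eps0 (Palpha (a j)).
  have := (hmax _ (a_gt0 j)).2 _ (stiefel_pid R hkn).
  by rewrite !penalizedE penalty_pid.
have upper : penalty eps0 Pstar <= c.
  exact: (penalty_limit_le a_gt0 a_oo (cvg_penalty aP (eps := eps0)) gP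
    beats_pid).
have eqc : penalty eps0 Pstar = c by apply/eqP; rewrite eq_le upper hc.1.
split=> //.
  by rewrite -eqc; apply: eq_bigr => i _; rewrite norm2_row_sq.
apply: stiefel_zero_one_rows => // i.
by move: hc.2; rewrite eqc eqxx => /esym/forallP.
Qed.
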